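(* For $R=\mathbb{Z}_9$ and for $R=\mathbb{S}_3=\mathbb{F}_3[X]/(X^2)$ we have $\mathrm{m}_7(R)\le 62$; that is, there is no projective $(63,7)$-arc in $\mathrm{PHG}(2,R)$.
   Context: For a finite chain ring $R$ of length $2$ with residue field $\mathbb{F}_q$, the projective Hjelmslev plane $\mathrm{PHG}(2,R)$ is the incidence structure whose points are the free rank-$1$ submodules of the right module $R_R^3$, whose lines are the free rank-$2$ submodules of $R_R^3$, with incidence given by inclusion. A projective $(k,n)$-arc is a set of $k$ points meeting every line in at most $n$ points. For $0\le n\le q^2+q$, $\mathrm{m}_n(R)$ denotes the largest $k$ such that a projective $(k,n)$-arc exists in $\mathrm{PHG}(2,R)$. *)

(* Defs.v *)
From HB Require Import structures.
From mathcomp Require Import all_boot all_order all_algebra.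
From mathcomp Require Import ring.

Set Implicit Arguments.
Unset Strict Implicit.
Unset Printing Implicit Defensive.

Import GRing.Theory.
Local Open Scope ring_scope.

(* The chain ring S_3 = F_3[X]/(X^2), realised as pairs (a, b) standing
   for a + b X, with (a,b)(c,d) = (ac, ad + bc).                       *)
Definition S3 : Type := ('F_3 * 'F_3)%type.
HB.instance Definition _ := Finite.on S3.
HB.instance Definition _ := GRing.Zmodule.on S3.

Definition S3mul (x y : S3) : S3 := (x.1 * y.1, x.1 * y.2 + x.2 * y.1).
Definition S3one : S3 := (1, 0).

Fact S3mulA : associative S3mul.
Proof. by move=> [a b] [c d] [e f]; rewrite /S3mul /=; congr pair => /=; ring. Qed.
Fact S3mulC : commutative S3mul.
Proof. by move=> [a b] [c d]; rewrite /S3mul /=; congr pair; ring. Qed.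
Fact S3mul1 : left_id S3one S3mul.
Proof. by move=> [a b]; rewrite /S3mul /=; congr pair; ring. Qed.
Fact S3mulDl : left_distributive S3mul +%R.
Proof. by move=> [a b] [c d] [e f]; rewrite /S3mul /=; congr pair => /=; ring. Qed.
Fact S3one_neq0 : S3one != 0.
Proof. by []. Qed.

HB.instance Definition _ :=
  GRing.Zmodule_isComNzRing.Build S3 S3mulA S3mulC S3mul1 S3mulDl S3one_neq0.

(* Projective Hjelmslev plane PHG(2,R) over a finite commutative ring R
   (so right and left modules coincide).  Vectors of R^3 are row
   vectors 'rV[R]_3; submodules are represented by their sets of
   elements.                                                           *)

(* free rank-1 submodule: P = xR with a |-> x a injective (x is a basis) *)
Definition is_point (R : finComNzRingType) (P : {set 'rV[R]_3}) : bool :=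
  [exists x : 'rV[R]_3,
     injectiveb (fun a : R => a *: x) && (P == [set a *: x | a : R])].

Definition is_line (R : finComNzRingType) (L : {set 'rV[R]_3}) : bool :=
  [exists x : 'rV[R]_3, exists y : 'rV[R]_3,
     injectiveb (fun ab : R * R => ab.1 *: x + ab.2 *: y) &&
     (L == [set ab.1 *: x + ab.2 *: y | ab : R * R])].

Definition is_proj_arc (R : finComNzRingType)
    (K : {set {set 'rV[R]_3}}) (n : nat) : Prop :=
  (forall P, P \in K -> is_point P) /\
  (forall L, is_line L -> (#|[set P in K | P \subset L]| <= n)%N).

(* Main.v *)
Require Import Defs.
From HB Require Import structures.
From mathcomp Require Import all_boot all_order all_algebra.
From mathcomp Require Import zify.

(* Write u(x) for the number of arc points in a neighbour class x (an affine
   plane of order 3), W(d) for the number of arc points in a line class d, and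
   assume that there are N >= 63 arc points.  The three lines of d through a
   line segment s of x in direction d partition the other points of d, so
   3 |s| + W(d) <= 21 + u(x).  Summing over the four directions,
   where sum_d W(d) = N + 3 u(x), and inspecting the 512 subsets of x leaves
   u(x) <= 4, or u(x) = 6 with the arc points forming two parallel full
   segments; in the latter case W = 18 in the direction d0 of these segments and
   W = 21 in the other three, so all the bounds are tight.
   On d0 there is no second class with u = 6: the three lines through the empty
   segment of x carry 12 arc points altogether, yet two of them would contain
   a full segment of the second class and hence 7 arc points each.  On the lines
   with W = 21 exactly three classes have u = 6.  As 63 > 13 * 4, some class has
   u = 6, and the classes with u = 6 would form a Fano plane in PG(2,3). *)

Set Implicit Arguments.
Unset Strict Implicit.
Unset Printing Implicit Defensive.

(** * Subsets as bit sequences; sums and counts over lists *)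

Fixpoint bitseqs n : seq bitseq :=
  if n is n'.+1 then
    [seq true :: b | b <- bitseqs n'] ++ [seq false :: b | b <- bitseqs n']
  else [:: [::]].

Lemma mem_bitseqs b : b \in bitseqs (size b).
Proof.
elim: b => [|[] b IHb] //=; rewrite mem_cat; apply/orP; [left|right];
  exact: map_f.
Qed.

Lemma sumn_map_le (I : eqType) (s : seq I) (f g : I -> nat) :
  {in s, forall i, f i <= g i} -> sumn (map f s) <= sumn (map g s).
Proof.
elim: s => //= i s IHs fg; apply: leq_add; first exact/fg/mem_head.
by apply: IHs => j sj; apply: fg; rewrite inE sj orbT.
Qed.

Lemma sumn_map_tight (I : eqType) (s : seq I) (f g : I -> nat) :
    {in s, forall i, f i <= g i} -> sumn (map g s) <= sumn (map f s) ->
  {in s, f =1 g}.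
Proof.
elim: s => //= i s IHs fg fgs.
have fgi : f i <= g i by exact/fg/mem_head.
have {fg} fg : {in s, forall j, f j <= g j}.
  by move=> j sj; apply: fg; rewrite inE sj orbT.
have fg' := sumn_map_le fg.
move=> j; rewrite inE => /predU1P[->|]; first by lia.
by apply: IHs => //; lia.
Qed.

Lemma sumn_map_add (I : Type) (s : seq I) (f g : I -> nat) :
  sumn [seq f i + g i | i <- s] = sumn (map f s) + sumn (map g s).
Proof. by elim: s => //= i s ->; lia. Qed.

Lemma sumn_map_const (I : Type) (s : seq I) n :
  sumn [seq n | _ <- s] = size s * n.
Proof. by elim: s => //= _ s ->; lia. Qed.

Lemma count_flattenE (T : Type) (k : pred T) (ss : seq (seq T)) :
  count k (flatten ss) = sumn (map (count k) ss).
Proof. exact: count_flatten. Qed.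

(** Turns the arc points on a segment into bits at positions of its class, so that one enumeration
    of bit sequences treats all arcs. *)
Lemma count_index (T : eqType) (k : pred T) (cl s : seq T) :
    {subset s <= cl} ->
  count (nth false (map k cl)) [seq index p cl | p <- s] = count k s.
Proof.
move=> scl; rewrite count_map; apply: eq_in_count => p /scl clp /=.
by rewrite (nth_map p) ?index_mem // nth_index.
Qed.

(** * Points of the plane and the quotient PG(2,3) *)

(* An element a + b t of the ring, with t = 3 in Z_9 and t = X in S_3, is
   encoded by the number a + 3 b. *)
Definition vec := (nat * nat * nat)%type.

(* Normalised representatives of the 117 points, grouped by neighbour class. *)
Definition hclasses : seq (seq vec) :=
  let D := iota 0 3 in
  [seq [seq (1, a + 3 * s, b + 3 * t) | s <- D, t <- D] | a <- D, b <- D] ++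
  [seq [seq (3 * s, 1, b + 3 * t) | s <- D, t <- D] | b <- D] ++
  [:: [seq (3 * s, 3 * t, 1) | s <- D, t <- D]].

Definition classes := iota 0 13.

Definition residue_orth (p q : vec) : bool :=
  (p.1.1 * q.1.1 + p.1.2 * q.1.2 + p.2 * q.2) %% 3 == 0.

(* By duality the line classes are also numbered by [classes]: the points [c] on
   the line [d] of PG(2,3) are those orthogonal to [d] modulo the radical. *)
Definition pg_lines : seq (seq nat) := Eval vm_compute in
  let rep c := head (0, 0, 0) (nth [::] hclasses c) in
  [seq [seq c <- classes | residue_orth (rep c) (rep d)] | d <- classes].

Definition on d := nth [::] pg_lines d.
Definition pencil c := [seq d <- classes | c \in on d].

(** The local picture at a point of a Fano plane inside PG(2,3): one tangent and three lines with
    three points each. *)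
Definition fano_point (S : pred nat) c :=
  has (fun d0 => all (fun d => count S (on d) == if d == d0 then 1 else 3)
                     (pencil c)) (pencil c).

(* [no_fano] in a form that shares the line counts of each subset. *)
Definition fano_free : bool :=
  let pencils := [seq pencil c | c <- classes] in
  all (fun b =>
    let m := [seq count (nth false b) l | l <- pg_lines] in
    ~~ has (nth false b) classes ||
    has (fun c => nth false b c &&
      ~~ has (fun d0 => all (fun d => nth 0 m d == if d == d0 then 1 else 3)
                           (nth [::] pencils c)) (nth [::] pencils c)) classes)
  (bitseqs 13).

Lemma fano_freeT : fano_free.
Proof. by vm_compute. Qed.

Lemma on_sub d c : d \in classes -> c \in on d -> c \in classes.
Proof.
have /allP sub : all (fun d => all (mem classes) (on d)) classes by [].
by move=> /sub/allP; apply.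
Qed.

(** If every point of a nonempty [S] had this local picture, [S] would have 1 + 3 * 2 = 7 points and
    form a Fano plane, impossible in characteristic 3. The proof runs through all 2^13 subsets. *)
Lemma no_fano (S : pred nat) :
  has S classes -> exists2 c, c \in classes & S c && ~~ fano_point S c.
Proof.
pose b := map S classes.
have Sb : {in classes, nth false b =1 S}.
  move=> c; rewrite mem_iota => c13.
  by rewrite (nth_map 0) ?size_iota // nth_iota.
have cntE d : d \in classes ->
    nth 0 [seq count (nth false b) l | l <- pg_lines] d = count S (on d).
  move=> dI; rewrite (nth_map [::]); last by move: dI; rewrite mem_iota.
  by apply: eq_in_count => c cd; apply/Sb/(on_sub dI).
have bin : b \in bitseqs 13 := mem_bitseqs b.
move=> /hasP[c0 c0I Sc0].
case/orP: (allP fano_freeT b bin) => [/hasPn/(_ c0 c0I)|].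
  by rewrite Sb // Sc0.
case/hasP=> c cI; rewrite Sb // => /andP[Sc nfano].
exists c => //; rewrite Sc; apply: contra nfano => /hasP[d0 d0c /allP fano_d0].
rewrite (nth_map 0) ?size_iota; last by move: cI; rewrite mem_iota.
rewrite nth_iota; last by move: cI; rewrite mem_iota.
apply/hasP; exists d0 => //; apply/allP => d dc.
rewrite cntE; first exact: fano_d0.
by move: dc; rewrite mem_filter => /andP[].
Qed.

Lemma size_pencil c : c \in classes -> size (pencil c) = 4.
Proof.
have /allP sz : all (fun c => size (pencil c) == 4) classes by [].
by move=> /sz/eqP.
Qed.

Lemma on_size_uniq d : d \in classes -> size (on d) = 4 /\ uniq (on d).
Proof.
have /allP sz : all (fun d => (size (on d) == 4) && uniq (on d)) classes by [].
by move=> /sz/andP[/eqP].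
Qed.

(** * The counting argument on lists of classes and lines *)

Section Arc.

(* [pc] lists the neighbour classes of points, [lc] the line classes; both are
   indexed by [classes]. *)
Variables (T : eqType) (pc : seq (seq T)) (lc : seq (seq (seq T))).

Definition cls c := nth [::] pc c.
Definition lns d := nth [::] lc d.
Definition trace c (l : seq T) := [seq p <- l | p \in cls c].
Definition segs c d := undup [seq trace c l | l <- lns d].
Definition thru (s : seq T) d := [seq l <- lns d | all (mem l) s].
Definition nbhd d := flatten [seq cls c | c <- on d].

(** The three lines through [s] cover [s] three times, no other point of [c], and each point of the
    other classes on [d] once. On each of those classes they cut out the different parallel
    segments. *)
Definition seg_check c d s :=
  let ls := thru s d in
  [&& size ls == 3, perm_eq (flatten ls ++ cls c) (s ++ s ++ s ++ nbhd d)
    & all (fun c' => if c' == c then true else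
             perm_eq [seq trace c' l | l <- ls] (segs c' d)) (on d)].

Definition line_check d :=
  all (fun c => (0 < size (segs c d)) && all (seg_check c d) (segs c d)) (on d).

(* [prof] lists, for each direction, the numbers of arc points on the three
   parallel segments. *)
Definition profile_ok u (prof : seq (nat * seq nat)) :=
  if 3 * sumn [seq foldr maxn 0 x.2 | x <- prof] <= u + 21 then
    (u <= 4) || (u == 6) &&
      has (fun x0 => all (fun x =>
        if x.1 == x0.1 then perm_eq x.2 [:: 3; 3; 0] else 2 \in x.2) prof) prof
  else true.

(** The [perm_eq] yields sum_d W(d) = N + 3 u(c): the line classes through [c] cover every other
    class once and [c] four times. *)
Definition class_check c :=
  let cl := cls c in
  let ds := [seq (d, [seq [seq index p cl | p <- s] | s <- segs c d])
            | d <- pencil c] in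
  [&& size cl == 9,
      perm_eq (flatten [seq nbhd d | d <- pencil c])
              (flatten pc ++ cl ++ cl ++ cl)
    & all (fun b => profile_ok (count id b)
        [seq (x.1, [seq count (nth false b) s | s <- x.2]) | x <- ds])
      (bitseqs 9)].

Definition plane_check :=
  [&& size pc == 13, all line_check classes & all class_check classes].

Lemma plane_arc_bound (k : pred T) :
    plane_check ->
    {in classes, forall d, {in lns d, forall l, count k l <= 7}} ->
  count k (flatten pc) <= 62.
Proof.
case/and3P=> /eqP size_pc /allP lineP /allP classP k7.
rewrite leqNgt; apply/negP => N63.
pose u c := count k (cls c).
pose W d := count k (nbhd d).
pose segc c d := [seq count k s | s <- segs c d].
have WE d : W d = sumn [seq u c | c <- on d].
  by rewrite /W /nbhd count_flattenE -map_comp.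
have thru_sum d c s : d \in classes -> c \in on d -> s \in segs c d ->
    size (thru s d) = 3 /\
    sumn (map (count k) (thru s d)) + u c = 3 * count k s + W d.
  move=> dI cd sS; have /andP[_ /allP/(_ s sS)] := allP (lineP d dI) c cd.
  case/and3P=> /eqP sz /permP/(_ k) E _; split=> //; move: E.
  by rewrite !count_cat count_flattenE -/(u c) -/(W d); lia.
have thru7 d s : d \in classes -> {in thru s d, forall l, count k l <= 7}.
  by move=> dI l; rewrite mem_filter => /andP[_]; apply: k7.
have seg_bound d c s : d \in classes -> c \in on d -> s \in segs c d ->
    3 * count k s + W d <= 21 + u c.
  move=> dI cd sS; have [sz <-] := thru_sum d c s dI cd sS.
  have : sumn (map (count k) (thru s d)) <= sumn [seq 7 | _ <- thru s d].
    exact: sumn_map_le (thru7 d s dI).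
  by rewrite sumn_map_const sz; lia.
have seg_tight d c s l : d \in classes -> c \in on d -> s \in segs c d ->
    3 * count k s + W d = 21 + u c -> l \in thru s d -> count k l = 7.
  move=> dI cd sS tight ls; have [sz E] := thru_sum d c s dI cd sS.
  apply: (@sumn_map_tight _ _ (count k) (fun=> 7) (thru7 d s dI)) ls.
  rewrite sumn_map_const sz.
  by suff : 21 <= sumn (map (count k) (thru s d)) by []; lia.
have pencil_sum c : c \in classes ->
    sumn [seq W d | d <- pencil c] = count k (flatten pc) + 3 * u c.
  move=> cI; have /and3P[_ /permP/(_ k) + _] := classP c cI.
  rewrite count_flattenE -map_comp !count_cat -/(u c) => E.
  by rewrite (eq_map (_ : W =1 count k \o nbhd)) // E; lia.
have max_bound d c : d \in classes -> c \in on d ->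
    3 * foldr maxn 0 (segc c d) + W d <= 21 + u c.
  move=> dI cd; have /andP[segs_gt0 _] := allP (lineP d dI) c cd.
  (* The maximum is folded from 0, so the base case needs this bound; any segment supplies it. *)
  have W_le : W d <= 21 + u c.
    case: (segs c d) segs_gt0 (fun s => seg_bound d c s dI cd) => // s0 r _ bnd.
    by have := bnd s0 (mem_head _ _); lia.
  have bnd n : n \in segc c d -> 3 * n + W d <= 21 + u c.
    by case/mapP=> s sS ->; apply: seg_bound.
  elim: (segc c d) bnd => [|n r IHr] bnd /=; first by lia.
  have := bnd n (mem_head _ _).
  have := IHr (fun m rm => bnd m (mem_behead (s := n :: r) rm)); lia.
have pencilP c d : d \in pencil c -> d \in classes /\ c \in on d.
  by rewrite mem_filter => /andP[].
have class_alt c : c \in classes -> u c <= 4 \/ u c = 6 /\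
    exists2 d0, d0 \in pencil c & {in pencil c, forall d,
      if d == d0 then perm_eq (segc c d) [:: 3; 3; 0] else 2 \in segc c d}.
  move=> cI; have /and3P[/eqP sz _ /allP ok] := classP c cI.
  have {ok} : profile_ok (u c) [seq (d, segc c d) | d <- pencil c].
    have bin : map k (cls c) \in bitseqs 9.
      by rewrite -sz -(size_map k); apply: mem_bitseqs.
    have := ok _ bin; rewrite count_map -map_comp; congr (profile_ok _ _).
    apply: eq_map => d /=; congr pair; rewrite -map_comp.
    apply/eq_in_map => s; rewrite mem_undup => /mapP[l _ ->] /=.
    by apply: count_index => p; rewrite mem_filter => /andP[].
  rewrite /profile_ok.
  (* Summing [max_bound] over the four directions gives 3 * (sum of maxima) + N + 3 u <= 84 + 4 u,
     and N >= 63. *)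
  have -> : 3 * sumn [seq foldr maxn 0 x.2
                     | x <- [seq (d, segc c d) | d <- pencil c]] <= u c + 21.
    rewrite -map_comp.
    rewrite -[X in sumn X]/[seq foldr maxn 0 (segc c d) | d <- pencil c].
    have : sumn [seq 3 * foldr maxn 0 (segc c d) + W d | d <- pencil c] <=
           sumn [seq 21 + u c | _ <- pencil c].
      by apply: sumn_map_le => d /pencilP[dI cd]; apply: max_bound.
    rewrite sumn_map_add sumn_map_const size_pencil // pencil_sum //.
    have -> : sumn [seq 3 * foldr maxn 0 (segc c d) | d <- pencil c] =
              3 * sumn [seq foldr maxn 0 (segc c d) | d <- pencil c].
      by elim: (pencil c) => //= d r ->; lia.
    by lia.
  case/orP=> [|/andP[/eqP u6 /hasP[_ /mapP[d0 d0c ->] /allP all_d]]].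
    by left.
  right; split=> //; exists d0 => // d dc.
  exact: all_d (map_f _ dc).
have W_six c : c \in classes -> u c = 6 ->
    exists2 d0, d0 \in pencil c & {in pencil c, forall d,
      W d = (if d == d0 then 18 else 21) /\
      (d == d0 -> perm_eq (segc c d) [:: 3; 3; 0])}.
  move=> cI u6; case: (class_alt c cI) => [|[_ [d0 d0c segP]]]; first by lia.
  exists d0 => // d dc; split; last by have := segP d dc; case: eqP.
  (* Segments with 3 and 2 arc points give the bounds 27 - 9 = 18 and 27 - 6 = 21. Their total 18 +
     3 * 21 = 81 equals 63 + 3 * 6, so equality holds throughout. *)
  have W_le : {in pencil c, forall e, W e <= if e == d0 then 18 else 21}.
    move=> e ec; have [eI ce] := pencilP c e ec; have := segP e ec.
    have bnd n : n \in segc c e -> 3 * n + W e <= 27.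
      by case/mapP=> s sS ->; have := seg_bound e c s eI ce sS; lia.
    case: eqP => _ seg; last by have := bnd _ seg; lia.
    by have := bnd 3; rewrite (perm_mem seg) => /(_ isT); lia.
  suff sum_le : sumn [seq if e == d0 then 18 else 21 | e <- pencil c] <=
      sumn (map W (pencil c)) by exact: (sumn_map_tight W_le sum_le).
  rewrite pencil_sum // u6.
  have : 0 < count_mem d0 (pencil c) by rewrite -has_count has_pred1.
  have : sumn [seq if e == d0 then 18 else 21 | e <- pencil c]
           + 3 * count_mem d0 (pencil c) = 21 * size (pencil c).
    elim: (pencil c) => //= e r IHr; case: eqP => _ /=; lia.
  by rewrite size_pencil //; lia.
have lonely d c c' : d \in classes -> c \in on d -> c' \in on d ->
    u c = 6 -> u c' = 6 -> W d = 18 -> c' = c.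
  move=> dI cd c'd u6 u6' W18; apply/eqP/negPn/negP => c'c.
  have full e : e \in on d -> u e = 6 -> perm_eq (segc e d) [:: 3; 3; 0].
    move=> ed ue; have [d0 _ /(_ d)] := W_six e (on_sub dI ed) ue.
    rewrite mem_filter ed dI W18 => /(_ isT)[+ p]; case: eqP p => // _.
    by move=> + _; apply.
  have : 0 \in segc c d by rewrite (perm_mem (full c cd u6)).
  case/mapP=> s sS s0; have [_] := thru_sum d c s dI cd sS.
  rewrite -s0 u6 W18 => thru12.
  have /andP[_ /allP/(_ s sS)/and3P[_ _ /allP/(_ c' c'd)]] :=
    allP (lineP d dI) c cd.
  rewrite (negPf c'c) => traceP.
  (* A full segment of [c'] is tight, as 3 * 3 + 18 = 21 + 6, so [h] of the trace bounds the arc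
     points of a line from below. The three traces have sizes 3, 3, 0, whence 14 <= 12. *)
  pose h n := if n == 3 then 7 else 0.
  have : sumn [seq h (count k (trace c' l)) | l <- thru s d] = 14.
    have -> : [seq h (count k (trace c' l)) | l <- thru s d] =
              map (h \o count k) [seq trace c' l | l <- thru s d].
      by rewrite -map_comp.
    rewrite (perm_sumn (perm_map _ traceP)) map_comp.
    by rewrite (perm_sumn (perm_map _ (full c' c'd u6'))).
  suff h_le : {in thru s d, forall l, h (count k (trace c' l)) <= count k l}.
    have : sumn [seq h (count k (trace c' l)) | l <- thru s d] <=
           sumn (map (count k) (thru s d)) by exact: sumn_map_le h_le.
    by lia.
  move=> l ls; rewrite /h; case: eqP => // cnt3.
  have lI : l \in lns d by move: ls; rewrite mem_filter => /andP[].
  rewrite (seg_tight d c' (trace c' l)) //.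
  - by rewrite mem_undup; apply: map_f.
  - by rewrite cnt3 W18 u6'.
  - rewrite mem_filter lI andbT; apply/allP => p.
    by rewrite mem_filter => /andP[].
(* With m classes of value 6, all 13 classes give 63 <= 52 + 2 m, so m > 0; a line class with W = 21
   gives 6 m <= 21 <= 16 + 2 m, so m = 3. *)
have sum_six (r : seq nat) : {subset r <= classes} ->
    6 * count (fun c => u c == 6) r <= sumn (map u r)
      <= 4 * size r + 2 * count (fun c => u c == 6) r.
  elim: r => //= c r IHr rI.
  have := IHr (fun e re => rI e (mem_behead (s := c :: r) re)).
  by case: (class_alt c (rI c (mem_head _ _))) => [|[+ _]]; case: eqP; lia.
have pcE : count k (flatten pc) = sumn (map u classes).
  rewrite count_flattenE -[in LHS](mkseq_nth [::] pc) size_pc -map_comp.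
  by [].
have [|c cI /andP[/eqP u6 /negP]] := @no_fano (fun c => u c == 6).
  rewrite has_count; have := sum_six classes (fun _ => id).
  by rewrite -pcE size_iota; lia.
apply; have [d0 d0c segP] := W_six c cI u6.
apply/hasP; exists d0 => //; apply/allP => d dc; apply/eqP.
have [dI cd] := pencilP c d dc; have [Wd _] := segP d dc.
have [sz un] := on_size_uniq dI.
case: eqP Wd => _ Wd; last first.
  by have := sum_six (on d) (fun e => @on_sub d e dI); rewrite sz -WE Wd; lia.
transitivity (count_mem c (on d)); last by rewrite count_uniq_mem // cd.
apply: eq_in_count => e ed /=; apply/eqP/eqP => [u6e|->] //.
exact: (lonely d c e).
Qed.

End Arc.

(** * From submodules of R^3 to coded coordinate vectors *)

Section Coordinates.
Variables (add mul : nat -> nat -> nat).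
Definition vscale a (p : vec) : vec := (mul a p.1.1, mul a p.1.2, mul a p.2).
Definition vadd (p q : vec) : vec :=
  (add p.1.1 q.1.1, add p.1.2 q.1.2, add p.2 q.2).
Definition dot (p q : vec) :=
  add (add (mul p.1.1 q.1.1) (mul p.1.2 q.1.2)) (mul p.2 q.2).
Definition codes := iota 0 9.

(** Lines are kernels of linear forms [al]; the forms in one neighbour class give one line class. *)
Definition hlines : seq (seq (seq vec)) :=
  let ps := flatten hclasses in
  [seq [seq [seq p <- ps | dot al p == 0] | al <- cl] | cl <- hclasses].

Definition mults p := [seq vscale a p | a <- codes].
Definition span2 p q := [seq vadd x y | x <- mults p, y <- mults q].

(* Entries 0 and 3 of a line lie in different neighbour classes, since a line
   meets a class in 0 or 3 points and these are listed consecutively. *)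
Definition basis_check (l : seq vec) :=
  let u := nth (0, 0, 0) l 0 in
  let v := nth (0, 0, 0) l 3 in
  all (fun a => all (fun b => if vadd (vscale a u) (vscale b v) == (0, 0, 0)
                 then (a == 0) && (b == 0) else true) codes) codes
  && let s := span2 u v in all (mem s) l.

(** Distinct multiples mean that [q] spans a free submodule; vectors that are multiples of each
    other span the same one. *)
Definition rep_check (ps : seq vec) q :=
  let m := mults q in
  if uniq m then has (fun p => if p \in ps then q \in mults p else false) m
  else true.

(* Distinct representatives span distinct points, and every vector spanning a
   free submodule spans a listed point. *)
Definition code_check :=
  let ps := flatten hclasses in
  all (fun p => let m := mults p in
    all (fun q => if q \in m then q == p else true) ps) ps
  && all (fun x => all (fun y => all (fun z => rep_check ps (x, y, z))
       codes) codes) codes.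

Definition coord_check :=
  [&& plane_check hclasses hlines, all (all basis_check) hlines & code_check].

Import GRing.Theory.
Local Open Scope ring_scope.

Variables (R : finComNzRingType) (code : R -> nat) (decode : nat -> R).
Hypothesis code_lt9 : forall x, (code x < 9)%N.
Hypothesis codeK : cancel code decode.
Hypothesis decodeK : {in codes, cancel decode code}.
Hypothesis code0 : code 0 = 0%N.
Hypothesis codeD : {morph code : x y / x + y >-> add x y}.
Hypothesis codeM : {morph code : x y / x * y >-> mul x y}.

Definition vcode (x : 'rV[R]_3) : vec :=
  (code (x 0 0), code (x 0 1), code (x 0 (2 : 'I_3))).
Definition vdecode (p : vec) : 'rV[R]_3 :=
  \row_i decode (nth 0%N [:: p.1.1; p.1.2; p.2] i).

Lemma code_inj : injective code. Proof. exact: can_inj codeK. Qed.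

Lemma mem_codes x : code x \in codes.
Proof. by rewrite mem_iota /= code_lt9. Qed.

Lemma vcodeK : cancel vcode vdecode.
Proof.
move=> x; apply/rowP=> i; rewrite mxE.
case: i => [[|[|[|//]]]] i3 /=; rewrite codeK; congr (x _ _); exact: val_inj.
Qed.

Definition wf_vec (p : vec) :=
  [&& p.1.1 \in codes, p.1.2 \in codes & p.2 \in codes].

Lemma vdecodeK p : wf_vec p -> vcode (vdecode p) = p.
Proof. by case: p => [[a b] c] /and3P[*]; rewrite /vcode !mxE /= !decodeK. Qed.

Lemma vcodeZ a x : vcode (a *: x) = vscale (code a) (vcode x).
Proof. by rewrite /vcode !mxE !codeM. Qed.

Lemma vcodeD x y : vcode (x + y) = vadd (vcode x) (vcode y).
Proof. by rewrite /vcode !mxE !codeD. Qed.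

Lemma vcode0 : vcode 0 = (0, 0, 0)%N.
Proof. by rewrite /vcode !mxE code0. Qed.

Definition span1 (x : 'rV[R]_3) := [set a *: x | a : R].

Lemma mem_span1 x y : (y \in span1 x) = (vcode y \in mults (vcode x)).
Proof.
apply/imsetP/mapP => [[a _ ->]|[i i9 E]].
  by exists (code a); rewrite ?mem_codes ?vcodeZ.
exists (decode i) => //; apply: (can_inj vcodeK).
by rewrite vcodeZ decodeK.
Qed.

Lemma span1_sub x (L : {set 'rV[R]_3}) :
  (forall a y, y \in L -> a *: y \in L) -> x \in L -> span1 x \subset L.
Proof. by move=> LZ Lx; apply/subsetP=> _ /imsetP[a _ ->]; apply: LZ. Qed.

Lemma span1Z x a y : y \in span1 x -> a *: y \in span1 x.
Proof. by case/imsetP=> b _ ->; rewrite scalerA; apply: imset_f. Qed.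

Lemma span1_id x : x \in span1 x.
Proof. by apply/imsetP; exists 1; rewrite ?scale1r. Qed.

Lemma injective_mults (x : 'rV[R]_3) :
  injective (fun a : R => a *: x) -> uniq (mults (vcode x)).
Proof.
move=> xinj; rewrite map_inj_in_uniq ?iota_uniq // => i j i9 j9 E.
rewrite -(decodeK i9) -(decodeK j9); congr code; apply: xinj.
by apply: (can_inj vcodeK); rewrite !vcodeZ !decodeK.
Qed.

(** Every point of [K] has a listed representative, and every listed line lies in the free span of
    two of its entries, hence carries at most 7 points of [K]. *)
Lemma arc_bound (K : {set {set 'rV[R]_3}}) :
  coord_check -> is_proj_arc K 7 -> (#|K| <= 62)%N.
Proof.
case/and3P=> planeP basisP /andP[/allP injP repP] [Kpt Kline].
pose pt p := span1 (vdecode p).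
pose k p := pt p \in K.
have wf_pts p : p \in flatten hclasses -> wf_vec p.
  by move: p; apply/allP.
have pt_inj : {in flatten hclasses &, injective pt}.
  move=> p q pP qP E; have := span1_id (vdecode q).
  rewrite -/(pt q) -E mem_span1 !vdecodeK ?wf_pts // => qp.
  by have := allP (injP p pP) q qP; rewrite qp => /eqP.
have k_card : (#|K| <= count k (flatten hclasses))%N.
  rewrite -size_filter -(size_map pt).
  apply: leq_trans (card_size _); apply: subset_leq_card.
  apply/subsetP => P KP.
  have /existsP[x /andP[/injectiveP xinj /eqP PE]] := Kpt P KP.
  have : rep_check (flatten hclasses) (vcode x).
    have := allP repP _ (mem_codes (x 0 0)).
    move=> /allP/(_ _ (mem_codes (x 0 1))).
    by move=> /allP/(_ _ (mem_codes (x 0 (2 : 'I_3)))).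
  rewrite /rep_check injective_mults // => /hasP[p px].
  case: ifP => // pP xp.
  have Ep : pt p = P.
    rewrite PE -/(span1 x); apply/eqP; rewrite eqEsubset.
    apply/andP; split; apply: span1_sub; try exact: span1Z.
      by rewrite mem_span1 vdecodeK ?wf_pts.
    by rewrite mem_span1 vdecodeK ?wf_pts.
  by apply/mapP; exists p => //; rewrite mem_filter /k Ep KP.
apply: leq_trans k_card _.
apply: plane_arc_bound planeP _ => d dI l ld.
have lines_d : lns hlines d \in hlines.
  by apply: mem_nth; move: dI; rewrite mem_iota size_map.
have /andP[kerP /allP spanP] := allP (allP basisP _ lines_d) l ld.
have lP : {subset l <= flatten hclasses}.
  move: ld; rewrite /lns (nth_map [::]); last by move: dI; rewrite mem_iota.
  by case/mapP=> al _ -> p; rewrite mem_filter => /andP[].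
move: kerP spanP; set u := nth _ l 0; set v := nth _ l 3 => kerP spanP.
(* The default vector is well formed too, which covers indices beyond the end of [l]. *)
have wf_nth i : wf_vec (nth (0, 0, 0)%N l i).
  have [il|il] := ltnP i (size l); first exact/wf_pts/lP/mem_nth.
  by rewrite nth_default.
pose x := vdecode u; pose y := vdecode v.
have xE : vcode x = u := vdecodeK (wf_nth 0%N).
have yE : vcode y = v := vdecodeK (wf_nth 3%N).
pose f (ab : R * R) := ab.1 *: x + ab.2 *: y.
have f_inj : injective f.
  move=> [a b] [a' b'] E.
  have : f (a - a', b - b') = 0.
    rewrite /f /= !scalerBl addrACA -opprD.
    by apply/eqP; rewrite subr_eq0; apply/eqP.
  move/(congr1 vcode); rewrite vcodeD !vcodeZ vcode0 xE yE /= => E0.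
  have := allP (allP kerP _ (mem_codes (a - a'))) _ (mem_codes (b - b')).
  rewrite E0 eqxx -code0 !(inj_eq code_inj) !subr_eq0.
  by case/andP=> /eqP-> /eqP->.
pose L := [set f ab | ab : R * R].
have Lline : is_line L.
  apply/existsP; exists x; apply/existsP; exists y.
  by rewrite eqxx andbT; apply/injectiveP.
have ptL p : p \in l -> pt p \subset L.
  move=> pl; apply: span1_sub.
    move=> a _ /imsetP[ab _ ->].
    apply/imsetP; exists (a * ab.1, a * ab.2) => //.
    by rewrite /f /= scalerDr !scalerA.
  have /allpairsP[[_ _] [/mapP[i i9 ->] /mapP[j j9 ->] /= E]] := spanP p pl.
  apply/imsetP; exists (decode i, decode j) => //; apply: (can_inj vcodeK).
  by rewrite vcodeD !vcodeZ !decodeK // xE yE vdecodeK ?wf_pts ?lP.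
have l_uniq : uniq l.
  move: ld; rewrite /lns (nth_map [::]); last by move: dI; rewrite mem_iota.
  by case/mapP=> al _ ->; apply: filter_uniq.
apply: leq_trans (Kline L Lline).
rewrite -size_filter -(size_map pt) -(card_uniqP _).
  apply/subset_leq_card/subsetP => _ /mapP[p + ->].
  by rewrite mem_filter inE => /andP[kp pl]; rewrite -/(k p) kp ptL.
rewrite map_inj_in_uniq ?filter_uniq // => p q.
rewrite !mem_filter => /andP[_ /lP pP] /andP[_ /lP qP]; exact: pt_inj.
Qed.

End Coordinates.

(** * The arithmetic of the two rings *)

Definition addZ9 i j := (i + j) %% 9.
Definition mulZ9 i j := (i * j) %% 9.

Lemma coord_check_Z9 : coord_check addZ9 mulZ9.
Proof. by vm_compute. Qed.

Definition addS3 i j := (i %% 3 + j %% 3) %% 3 + 3 * ((i %/ 3 + j %/ 3) %% 3).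
Definition mulS3 i j :=
  (i %% 3 * (j %% 3)) %% 3
  + 3 * ((i %% 3 * (j %/ 3) + i %/ 3 * (j %% 3)) %% 3).

Lemma coord_check_S3 : coord_check addS3 mulS3.
Proof. by vm_compute. Qed.

Definition codeS3 (x : S3) : nat := x.1 + 3 * x.2.
Definition decodeS3 i : S3 := (inZp i, inZp (i %/ 3)).

Lemma codeS3_mod x : codeS3 x %% 3 = x.1.
Proof.
case: x => [[a a3] [b b3]].
by rewrite /codeS3 /= -modnDmr modnMr addn0 modn_small.
Qed.

Lemma codeS3_div x : codeS3 x %/ 3 = x.2.
Proof.
case: x => [[a a3] [b b3]]; rewrite /codeS3 /= addnC mulnC divnMDl //.
by rewrite divn_small ?addn0.
Qed.

(* m_7(Z_9) <= 62 and m_7(S_3) <= 62 *)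
Theorem theorem4p13 :
  (forall K : {set {set 'rV['Z_9]_3}}, is_proj_arc K 7 -> (#|K| <= 62)%N) /\
  (forall K : {set {set 'rV[S3]_3}}, is_proj_arc K 7 -> (#|K| <= 62)%N).
Proof.
split=> K.
  apply: (@arc_bound _ _ _ (fun x : 'Z_9 => x : nat) inZp _ _ _ _ _ _ _
            coord_check_Z9) => //.
  - exact: valZpK.
  - by move=> i; rewrite mem_iota => i9 /=; rewrite modn_small.
apply: (@arc_bound _ _ _ codeS3 decodeS3 _ _ _ _ _ _ _ coord_check_S3) => //.
- by case=> [[a a3] [b b3]]; rewrite /codeS3 /=;
    rewrite -[_.+2]/3 in a3 b3; lia.
- move=> x; rewrite [RHS]surjective_pairing; congr pair; apply: val_inj => /=.
    by rewrite codeS3_mod.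
  by rewrite codeS3_div modn_small.
- move=> i; rewrite mem_iota => /= i9.
  by suff : i %% 3 + 3 * (i %/ 3 %% 3) = i by []; lia.
- by move=> x y; rewrite /addS3 !codeS3_mod !codeS3_div.
(* In the second coordinate the field reduces both products modulo 3 before adding, whereas [mulS3]
   reduces only their sum. *)
- by move=> x y; rewrite /mulS3 !codeS3_mod !codeS3_div /codeS3 /= modnDm.
Qed.
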